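(* Let $N>10^{(10^{13})}$ be an LG number, and write $N=\prod_{i=1}^{r}p_i^{a_i}$ with primes $p_1<p_2<\cdots<p_r$ and exponents $a_i\ge 1$. Then for every $1\le i\le r$, $$a_i\ge \left\lfloor \frac{\log p_r}{\log p_i}\right\rfloor .$$
   Context: $\log$ is the natural logarithm, $\gamma$ is the Euler–Mascheroni constant, $\sigma(n)=\sum_{d\mid n}d$, $\rho(n)=\sigma(n)/n$, and $G(n)=\rho(n)/\log\log n$. A counterexample to the Robin hypothesis is an integer $n>5040$ with $G(n)\ge e^{\gamma}$. An LG (largest $G$-value) number is a counterexample $N>5040$ at which $G$ attains its largest value among counterexamples; equivalently, $N>5040$, $G(N)\ge e^\gamma$, and $G(m)\le G(N)$ for all integers $m>5040$. (Existence of LG numbers is not asserted.) *)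

(* Defs.v *)
From Stdlib Require Export Reals.
From Coquelicot Require Export Coquelicot.
From mathcomp Require Export all_boot.

Set Implicit Arguments.
Unset Strict Implicit.
Unset Printing Implicit Defensive.

Open Scope R_scope.

(* The term of index 0 involves the junk value of ln at 0; it does not affect
   the limit. *)
Definition euler_gamma : R :=
  real (Lim_seq (fun n : nat => sum_n_m (fun k : nat => / INR k) 1 n - ln (INR n))).

Definition sigma (n : nat) : nat := (\sum_(d <- divisors n) d)%N.

Definition rho (n : nat) : R := INR (sigma n) / INR n.

Definition G (n : nat) : R := rho n / ln (ln (INR n)).

Definition robin_counterexample (n : nat) : Prop :=
  5040 < INR n /\ exp euler_gamma <= G n.

Definition LG (N : nat) : Prop :=
  robin_counterexample N /\
  forall m : nat, robin_counterexample m -> G m <= G N.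

(* Main.v *)
Require Import Defs.
From Stdlib Require Import Lra Lia.

(** Write [L = ln N], let [P] be a prime divisor of [N] (the largest one, in
    the application), [p] a prime divisor with exponent [a], and suppose that
    [p ^ (a + 1) <= P].  Two competitors of [N] are then available, and one of
    them has a larger value of [G].

    Multiplying by [p] multiplies [rho] by [1 + x], where
    [x = (p - 1) / (p (p ^ (a + 1) - 1)) > (p - 1) / (p P)]
    ([rho_pfactorS], [pgain_gt]), and since [a >= 1] we have [p ^ 2 <= P], so
    that [2 ln p <= ln P].

    If [P <= L], the competitor is [p N].  As [ln] is concave, [ln ln] grows by
    at most [ln p / L], so maximality of [G N] forces [x L ln L <= ln p].  Hence
    [(p - 1) ln L < p ln p], while [ln L >= ln P >= 2 ln p]; this gives
    [2 (p - 1) < p], which is absurd ([LG_ln_lt_of_pfactorS_le]).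

    If [P > L], the competitor is [p N / P].  Dividing by [P] divides [rho] by
    at most [1 + 1 / P], so the net loss in [rho] is of relative size below
    [1 / P - (p - 1) / (p P) <= 1 / (2 P)].  But [ln N] drops by
    [ln (P / p) >= ln P / 2 > ln L / 2], so [ln ln N] drops by a relative amount
    larger than [1 / (2 L) > 1 / (2 P)], and [G] increases
    ([LG_prime_lt_pfactorS]).

    The second competitor must exceed 5040 ([LG_cofactor_big]), and it is here
    that [N] has to be large.  Since Euler's constant is nonnegative, a
    counterexample has [rho N >= ln ln N], which is at least 26 for the [N]
    considered, so [rho (N / P) > 17], whereas [rho m <= 1 + ln m < 17] for [m <= 5040]. *)

Set Implicit Arguments.
Unset Strict Implicit.
Unset Printing Implicit Defensive.

(** * Natural numbers as reals *)

Lemma INR_muln m n : INR (m * n)%N = INR m * INR n.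
Proof. by rewrite -multE mult_INR. Qed.

Lemma INR_addn m n : INR (m + n)%N = INR m + INR n.
Proof. by rewrite -plusE plus_INR. Qed.

Lemma INR_expn m k : INR (m ^ k)%N = INR m ^ k.
Proof. by elim: k => [|k IH] //; rewrite expnS INR_muln IH. Qed.

Lemma INR_leq m n : (m <= n)%N -> INR m <= INR n.
Proof. by move/leP; apply: le_INR. Qed.

Lemma INR_ltn m n : (m < n)%N -> INR m < INR n.
Proof. by move/ltP; apply: lt_INR. Qed.

Lemma prime_ge2 p : prime p -> 2 <= INR p.
Proof. by move/prime_gt1/INR_leq. Qed.

(** * The effect of a prime factor on the sum of divisors *)

Lemma sigma_gt0 n : (0 < n)%N -> 0 < INR (sigma n).
Proof.
move=> n_gt0; apply: (INR_ltn (m := 0)).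
rewrite /sigma (big_rem n) ?divisors_id //=.
by rewrite addn_gt0 n_gt0.
Qed.

Lemma rho_gt0 n : (0 < n)%N -> 0 < rho n.
Proof.
move=> n_gt0; apply: Rdiv_lt_0_compat; first exact: sigma_gt0.
exact: (INR_ltn (m := 0)).
Qed.

(** The divisors of [p ^ a.+1 * m] that are multiples of [p] are [p] times the
    divisors of [p ^ a * m]; the others are the divisors of [m]. *)
Lemma sigma_pfactorS p a m : prime p -> ~~ (p %| m)%N ->
  sigma (p ^ a.+1 * m) = (p * sigma (p ^ a * m) + sigma m)%N.
Proof.
move=> pr_p p'm.
have p_gt0 := prime_gt0 pr_p.
have m_gt0 : (0 < m)%N by case: m p'm => //; rewrite dvdn0.
have pam_gt0 b : (0 < p ^ b * m)%N by rewrite muln_gt0 expn_gt0 p_gt0.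
have split_div : perm_eq (divisors (p ^ a.+1 * m))
    ([seq (p * e)%N | e <- divisors (p ^ a * m)] ++ divisors m).
  apply: uniq_perm; first exact: divisors_uniq.
    rewrite cat_uniq divisors_uniq andbT map_inj_uniq ?divisors_uniq /=.
      apply/hasPn => d; rewrite -dvdn_divisors // => d_m.
      apply/negP => /mapP [e _ def_d]; move/negP: p'm; apply.
      by apply: dvdn_trans d_m; rewrite def_d dvdn_mulr.
    by move=> e f /eqP; rewrite eqn_pmul2l // => /eqP.
  move=> d; rewrite mem_cat -!dvdn_divisors //.
  apply/idP/orP => [d_pam | [/mapP [e] | d_m]].
  - have [/dvdnP [e def_d] | p'd] := boolP (p %| d)%N.
      left; apply/mapP; exists e; last by rewrite mulnC.
      rewrite -dvdn_divisors //.
      by move: d_pam; rewrite def_d mulnC expnS -mulnA dvdn_pmul2l.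
    right; move: d_pam; rewrite Gauss_dvdr //.
    by rewrite coprime_sym coprimeXl // prime_coprime.
  - rewrite -dvdn_divisors // => e_pam ->.
    by rewrite expnS -mulnA dvdn_pmul2l.
  - by rewrite dvdn_mull.
rewrite /sigma (perm_big _ split_div) big_cat big_map /=.
by rewrite big_distrr.
Qed.

Lemma sigma_pfactor p a m : prime p -> ~~ (p %| m)%N ->
  (INR p - 1) * INR (sigma (p ^ a * m)) = (INR p ^ a.+1 - 1) * INR (sigma m).
Proof.
move=> pr_p p'm; elim: a => [|a IH]; first by rewrite mul1n; ring.
rewrite sigma_pfactorS // INR_addn INR_muln.
rewrite Rmult_plus_distr_l -Rmult_assoc (Rmult_comm _ (INR p)) Rmult_assoc IH.
by rewrite /=; ring.
Qed.

(** The relative increase of [rho] when the exponent of [p] passes from [a] to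
    [a.+1]; it equals [1 / (p + p ^ 2 + ... + p ^ a.+1)]. *)
Definition pgain (p a : nat) : R := (INR p - 1) / (INR p * (INR p ^ a.+1 - 1)).

Lemma prime_le_pow p a : prime p -> INR p <= INR p ^ a.+1.
Proof.
move=> /prime_ge2 p2; rewrite /=.
have := pow_R1_Rle (INR p) a ltac:(lra); nra.
Qed.

Lemma rho_pfactorS p a m : prime p -> ~~ (p %| m)%N ->
  rho (p ^ a.+1 * m) = rho (p ^ a * m) * (1 + pgain p a).
Proof.
move=> pr_p p'm; have p2 := prime_ge2 pr_p; have pa := prime_le_pow a pr_p.
have m_gt0 : (0 < m)%N by case: m p'm => //; rewrite dvdn0.
have m0 : 0 < INR m by apply: (INR_ltn (m := 0)).
have pa0 : 0 < INR p ^ a by apply: pow_lt; lra.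
have E := sigma_pfactor a pr_p p'm.
have E1 : INR (sigma m) =
    (INR p - 1) * INR (sigma (p ^ a * m)) / (INR p ^ a.+1 - 1).
  by rewrite E; field; lra.
rewrite /rho sigma_pfactorS // INR_addn !INR_muln !INR_expn E1 /pgain.
rewrite /= in pa *.
by field; lra.
Qed.

Lemma pgain_gt p a P : prime p -> (p ^ a.+1 <= P)%N ->
  (INR p - 1) / (INR p * INR P) < pgain p a.
Proof.
move=> pr_p /INR_leq; rewrite INR_expn => leP.
have p2 := prime_ge2 pr_p; have pa := prime_le_pow a pr_p.
apply: Rmult_lt_compat_l; first lra.
apply: Rinv_lt_contravar; last by apply: Rmult_lt_compat_l; lra.
by apply: Rmult_lt_0_compat; apply: Rmult_lt_0_compat; lra.
Qed.

(** The gain is largest, namely [1 / P], for the first factor [P]; hence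
    removing one factor [P] from a number costs at most [1 + 1 / P] in [rho]. *)
Lemma pgain_le P b : prime P -> pgain P b <= / INR P.
Proof.
move=> pr_P; have P2 := prime_ge2 pr_P; have Pb := prime_le_pow b pr_P.
have -> : / INR P = (INR P - 1) / (INR P * (INR P - 1)) by field; lra.
apply: Rmult_le_compat_l; first lra.
by apply: Rinv_le_contravar; nra.
Qed.

(** * Logarithms and harmonic sums *)

Lemma ln_le_sub1 x : 0 < x -> ln x <= x - 1.
Proof. by move=> x0; have := exp_ineq1_le (ln x); rewrite exp_ln //; lra. Qed.

(** Concavity: the logarithm lies below its tangent at [L]. *)
Lemma ln_add_le L h : 0 < L -> 0 < L + h -> ln (L + h) <= ln L + h / L.
Proof.
move=> L0 Lh0.
have -> : L + h = L * (1 + h / L) by field; lra.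
have q0 : 0 < 1 + h / L.
  by have -> : 1 + h / L = (L + h) / L; [field; lra | apply: Rdiv_lt_0_compat].
by rewrite ln_mult //; have := ln_le_sub1 q0; lra.
Qed.

Lemma ln_succ_bounds k : (0 < k)%N ->
  / INR k.+1 <= ln (INR k.+1) - ln (INR k) <= / INR k.
Proof.
move=> /(INR_ltn (m := 0)); rewrite [INR 0]/= => k0; rewrite S_INR.
have := ln_add_le (h := 1) k0 ltac:(lra).
have := ln_add_le (L := INR k + 1) (h := -1) ltac:(lra) ltac:(lra).
have -> : INR k + 1 + -1 = INR k by ring.
by rewrite /Rdiv; lra.
Qed.

(** Each term of the defining sequence is nonnegative, since comparing [1 / k]
    with the increments of [ln] bounds the harmonic sum below by
    [ln (n + 1)]. *)
Lemma euler_gamma_ge0 : 0 <= euler_gamma.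
Proof.
pose u n := sum_n_m (fun k : nat => / INR k) 1 n - ln (INR n).
have step n : ln (INR n.+1) <= sum_n_m (fun k : nat => / INR k) 1 n.
  elim: n => [|n IH]; first by rewrite sum_n_m_zero //= ln_1; apply: Rle_refl.
  rewrite sum_n_Sm; last by apply/leP.
  have [_ ub] := ln_succ_bounds (ltn0Sn n).
  apply: (Rle_trans _ (ln (INR n.+1) + / INR n.+1)); first lra.
  exact: Rplus_le_compat_r.
have u_ge0 n : (0 < n)%N -> 0 <= u n.
  move=> n_gt0; have n0 := INR_ltn n_gt0; rewrite [INR 0]/= in n0.
  have := step n; have := ln_le _ _ n0 (INR_leq (leqnSn n)); rewrite /u; lra.
have : Rbar_le (Lim_seq (fun=> 0)) (Lim_seq u).
  by apply: Lim_seq_le_loc; exists 1%N => n /leP /u_ge0.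
rewrite Lim_seq_const /euler_gamma -/u.
by case: (Lim_seq u) => [x||] //= _; apply: Rle_refl.
Qed.

(** Codivisors: [sigma n] is also the sum of [n / d] over the divisors [d] of
    [n], which is bounded by the sum over all [d <= n]. *)
Lemma sigma_le_sum_divn n : (0 < n)%N ->
  (sigma n <= \sum_(1 <= d < n.+1) n %/ d)%N.
Proof.
move=> n_gt0.
have codiv : perm_eq (divisors n) [seq (n %/ d)%N | d <- divisors n].
  have invol d : (d %| n)%N -> (n %/ (n %/ d))%N = d.
    by move=> d_n; rewrite -{1}(divnK d_n) mulKn // divn_gt0 ?(dvdn_gt0 n_gt0) // dvdn_leq.
  apply: uniq_perm; first exact: divisors_uniq.
    rewrite map_inj_in_uniq ?divisors_uniq // => d e.
    rewrite -!dvdn_divisors // => d_n e_n eq_de.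
    by rewrite -(invol d d_n) eq_de invol.
  move=> d; apply/idP/mapP => [|[e e_n ->]].
    rewrite -dvdn_divisors // => d_n.
    by exists (n %/ d)%N; rewrite ?invol // -dvdn_divisors // dvdn_div.
  by rewrite -dvdn_divisors // dvdn_div // dvdn_divisors.
have mem_le : perm_eq (divisors n) [seq d <- index_iota 1 n.+1 | (d %| n)%N].
  apply: uniq_perm; rewrite ?divisors_uniq ?filter_uniq ?iota_uniq // => d.
  rewrite mem_filter mem_index_iota -dvdn_divisors // ltnS.
  have [d_n|//] := boolP (d %| n)%N.
  by rewrite (dvdn_gt0 n_gt0 d_n) dvdn_leq.
rewrite /sigma (perm_big _ codiv) big_map (perm_big _ mem_le) big_filter big_mkcond.
by apply: leq_sum => d _; case: ifP.
Qed.

(** By the codivisor bound, [rho n] is at most the harmonic sum up to [n]. *)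
Lemma rho_le n : (0 < n)%N -> rho n <= 1 + ln (INR n).
Proof.
move=> n_gt0; have n0 := INR_ltn n_gt0; rewrite [INR 0]/= in n0.
have sum_le k : INR (\sum_(1 <= d < k.+2) n %/ d) <= INR n * (1 + ln (INR k.+1)).
  elim: k => [|k IH]; first by rewrite big_nat1 divn1 /= ln_1; lra.
  rewrite big_nat_recr //= -/(INR k.+2) INR_addn.
  have [lnk _] := ln_succ_bounds (ltn0Sn k).
  have k0 := INR_ltn (ltn0Sn k.+1); rewrite [INR 0]/= in k0.
  have : INR (n %/ k.+2) <= INR n * / INR k.+2.
    apply: (Rmult_le_reg_r (INR k.+2)) => //.
    rewrite Rmult_assoc Rinv_l; last lra.
    by rewrite Rmult_1_r -INR_muln; apply/INR_leq/leq_trunc_div.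
  by nra.
apply: (Rmult_le_reg_r (INR n)) => //.
rewrite /rho /Rdiv Rmult_assoc Rinv_l; last lra.
rewrite Rmult_1_r Rmult_comm.
apply: Rle_trans (INR_leq (sigma_le_sum_divn n_gt0)) _.
by case: n n_gt0 n0 sum_le => // n _ _; apply.
Qed.

(** A numerical lower bound for [ln], resting only on [exp 1 <= 3]. *)
Lemma ln_ge_of_pow3_le k x : 3 ^ k <= x -> INR k <= ln x.
Proof.
move=> kx; rewrite -(ln_exp (INR k)); apply: ln_le; first exact: exp_pos.
apply: Rle_trans kx; elim: k => [|k IH]; first by rewrite exp_0; lra.
rewrite S_INR exp_plus Rmult_comm -tech_pow_Rmult.
have e3 := exp_le_3; have e0 := exp_pos 1; have ek := exp_pos (INR k).
by apply: Rmult_le_compat; lra.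
Qed.

Lemma ln_gt1 n : 5040 < INR n -> 1 < ln (INR n).
Proof.
by move=> n5040; have := @ln_ge_of_pow3_le 2 (INR n) ltac:(simpl; lra); simpl; lra.
Qed.

Lemma lnln_ge26 N : Rpower 10 (10 ^ 13) < INR N -> 26 <= ln (ln (INR N)).
Proof.
move=> N_big; have ln10 := @ln_ge_of_pow3_le 2 10 ltac:(simpl; lra).
have p13 : 0 < 10 ^ 13 by apply: pow_lt; lra.
have lnN : 10 ^ 13 <= ln (INR N).
  have : 10 ^ 13 * ln 10 < ln (INR N).
    by rewrite -(ln_Rpower 10 (10 ^ 13)); apply: ln_increasing; first exact: exp_pos.
  by simpl in ln10; nra.
have := ln_le _ _ p13 lnN; rewrite ln_pow; last lra.
have -> : INR 13 = 13 by rewrite INR_IZR_INZ.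
rewrite [INR 2]/= in ln10; lra.
Qed.

(** * LG numbers *)

(** [G N] is maximal among all [m > 5040], counterexamples or not: a number
    that is not a counterexample has [G m < exp euler_gamma <= G N]. *)
Lemma LG_max N m : LG N -> 5040 < INR m -> G m <= G N.
Proof.
move=> [[_ GN] maxN] m5040.
have [Gm | Gm] := Rle_lt_dec (exp euler_gamma) (G m); last lra.
exact: maxN.
Qed.

(** Maximality with the denominators cleared, the form in which competitors
    are compared with [N]. *)
Lemma LG_cross N m : LG N -> 5040 < INR m ->
  rho m * ln (ln (INR N)) <= rho N * ln (ln (INR m)).
Proof.
move=> LGN m5040; have [[N5040 _] _] := LGN.
have lnln_gt0 n : 5040 < INR n -> 0 < ln (ln (INR n)).
  by move=> /ln_gt1 n1; rewrite -ln_1; apply: ln_increasing; lra.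
have N0 := lnln_gt0 _ N5040; have m0 := lnln_gt0 _ m5040.
have := LG_max LGN m5040; rewrite /G => GmN.
have -> : rho m = rho m / ln (ln (INR m)) * ln (ln (INR m)) by field; lra.
have -> : rho N = rho N / ln (ln (INR N)) * ln (ln (INR N)) by field; lra.
have := Rmult_le_compat_r _ _ _ (Rlt_le _ _ (Rmult_lt_0_compat _ _ m0 N0)) GmN.
by lra.
Qed.

Lemma robin_rho_ge N : robin_counterexample N -> ln (ln (INR N)) <= rho N.
Proof.
move=> [/ln_gt1 N1 GN].
have N0 : 0 < ln (ln (INR N)) by rewrite -ln_1; apply: ln_increasing; lra.
have -> : rho N = G N * ln (ln (INR N)) by rewrite /G; field; lra.
have := exp_ineq1_le euler_gamma; have := euler_gamma_ge0; nra.
Qed.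

Lemma split_prime_factor p n : (0 < n)%N -> prime p ->
  exists2 m, ~~ (p %| m)%N & n = (p ^ logn p n * m)%N.
Proof.
move=> n_gt0 pr_p; have [m co def_n] := pfactor_coprime pr_p n_gt0.
by exists m; rewrite -?prime_coprime // mulnC.
Qed.

(** If [M <= 5040] then [rho M <= 1 + ln 5040 <= 14], as [5040 <= 2 ^ 13]; but
    [rho M] is at least [2 / 3] of [rho N >= 26]. *)
Lemma LG_cofactor_big N P M : LG N -> Rpower 10 (10 ^ 13) < INR N ->
  prime P -> N = (P * M)%N -> 5040 < INR M.
Proof.
move=> [robN _] N_big pr_P def_N; have P2 := prime_ge2 pr_P.
have rhoN := Rle_trans _ _ _ (lnln_ge26 N_big) (robin_rho_ge robN).
have M_gt0 : (0 < M)%N.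
  have [+ _] := robN; rewrite def_N.
  by case: M {def_N} => //; rewrite muln0 /=; lra.
have [m P'm def_M] := split_prime_factor M_gt0 pr_P.
have rhoM : 17 < rho M.
  have := pgain_le (logn P M) pr_P; have := Rinv_le_contravar 2 (INR P) ltac:(lra) P2.
  have rM := rho_gt0 M_gt0.
  move: rhoN; rewrite def_N {1}def_M mulnA -expnS rho_pfactorS // -def_M.
  by nra.
apply: Rnot_le_lt => M_small.
have M0 : 0 < INR M by apply: (INR_ltn (m := 0)).
have := rho_le M_gt0; have := ln_le _ _ M0 M_small.
have ln2 : ln 2 <= 1 by have := @ln_le_sub1 2 ltac:(lra); lra.
have : ln 5040 <= ln (2 ^ 13) by apply: ln_le; simpl; lra.
by rewrite ln_pow; simpl; lra.
Qed.

Lemma ln_prime_sq_le p N P : prime p -> (0 < N)%N -> (p %| N)%N ->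
  (p ^ (logn p N).+1 <= P)%N -> 2 * ln (INR p) <= ln (INR P).
Proof.
move=> pr_p N_gt0 p_N le_paP; have p2 := prime_ge2 pr_p.
have p2_le_P : (p ^ 2 <= P)%N.
  apply: leq_trans le_paP; rewrite leq_pexp2l ?prime_gt0 // ltnS.
  by rewrite logn_gt0 mem_primes pr_p N_gt0.
have : ln (INR p ^ 2) <= ln (INR P).
  by apply: ln_le; [simpl; nra | rewrite -INR_expn; apply: INR_leq].
by rewrite ln_pow; [rewrite [INR 2]/=; lra | lra].
Qed.

(** Comparison of [N] with [p N]: if [P] were at most [ln N], the gain in
    [rho], more than [(p - 1) / (p P)], would outweigh the
    relative increase of [ln ln N], at most [ln p / (ln N * ln ln N)]. *)
Lemma LG_ln_lt_of_pfactorS_le N p P : LG N -> prime p -> prime P ->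
  (p %| N)%N -> (p ^ (logn p N).+1 <= P)%N -> ln (INR N) < INR P.
Proof.
move=> LGN pr_p pr_P p_N le_paP; apply: Rnot_le_lt => P_le_L.
have [[N5040 _] _] := LGN; have L1 := ln_gt1 N5040.
have N_gt0 : (0 < N)%N by apply/ltP/INR_lt => /=; lra.
have p2 := prime_ge2 pr_p; have P2 := prime_ge2 pr_P.
have gain := pgain_gt pr_p le_paP.
have lnp0 : 0 < ln (INR p) by rewrite -ln_1; apply: ln_increasing; lra.
have lnpP := ln_prime_sq_le pr_p N_gt0 p_N le_paP.
set L := ln (INR N) in L1 P_le_L.
have [m p'm def_N] := split_prime_factor N_gt0 pr_p.
have pN5040 : 5040 < INR (p * N) by rewrite INR_muln; nra.
have := LG_cross LGN pN5040.
rewrite INR_muln ln_mult; try lra.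
rewrite {1}def_N mulnA -expnS rho_pfactorS // -def_N -/L.
set x := pgain _ _ in gain *; move=> cross.
have rN := rho_gt0 N_gt0.
have x_bound : (1 + x) * ln L <= ln L + ln (INR p) / L.
  apply: Rle_trans (ln_add_le (L := L) (h := ln (INR p)) _ _); try lra.
  rewrite (Rplus_comm L).
  by apply: (Rmult_le_reg_l (rho N)) => //; lra.
(* The increase of [ln ln N] bounds the gain from above, [pgain_gt] from below. *)
have xL : x * L * ln L <= ln (INR p).
  have := Rmult_le_compat_l L _ _ ltac:(lra) x_bound.
  have -> : L * (ln L + ln (INR p) / L) = L * ln L + ln (INR p) by field; lra.
  by lra.
have lnP_L : ln (INR P) <= ln L by apply: ln_le; lra.
have x_gt : INR p - 1 < x * INR p * L.
  have pP0 : 0 < INR p * INR P by apply: Rmult_lt_0_compat; lra.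
  have x0 : 0 < x by apply: Rlt_trans gain; apply: Rdiv_lt_0_compat; lra.
  have := Rmult_lt_compat_r _ _ _ pP0 gain.
  rewrite /Rdiv Rmult_assoc Rinv_l; last lra.
  have := Rmult_le_compat_l (x * INR p) _ _ _ P_le_L.
  by have := Rmult_lt_0_compat x (INR p) x0 ltac:(lra); lra.
have lnL0 : 0 < ln L by lra.
have := Rmult_lt_compat_r _ _ _ lnL0 x_gt.
have := Rmult_le_compat_l (INR p) _ _ ltac:(lra) xL.
by nra.
Qed.

(** Since [P > ln N] by the first comparison, [N] can be compared with
    [p N / P]: the relative loss in [rho], less than [1 / (2 P)], is outweighed
    by the decrease of [ln ln N]. *)
Lemma LG_prime_lt_pfactorS N p P : LG N -> Rpower 10 (10 ^ 13) < INR N ->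
  prime p -> prime P -> (p %| N)%N -> (P %| N)%N -> (P < p ^ (logn p N).+1)%N.
Proof.
move=> LGN N_big pr_p pr_P p_N P_N; rewrite ltnNge; apply/negP => le_paP.
have L_lt_P := LG_ln_lt_of_pfactorS_le LGN pr_p pr_P p_N le_paP.
have [[N5040 _] _] := LGN; have L1 := ln_gt1 N5040.
have lnL := lnln_ge26 N_big.
have N_gt0 : (0 < N)%N by apply/ltP/INR_lt => /=; lra.
have p2 := prime_ge2 pr_p; have P2 := prime_ge2 pr_P.
have gain := pgain_gt pr_p le_paP.
have lnp0 : 0 < ln (INR p) by rewrite -ln_1; apply: ln_increasing; lra.
have lnpP := ln_prime_sq_le pr_p N_gt0 p_N le_paP.
set L := ln (INR N) in L1 lnL L_lt_P.
have [M def_N] := dvdnP P_N; rewrite mulnC in def_N.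
have M5040 := LG_cofactor_big LGN N_big pr_P def_N.
have M_gt0 : (0 < M)%N by apply/ltP/INR_lt => /=; lra.
have pP_neq : p != P.
  by apply/eqP => eq_pP; rewrite eq_pP in lnp0 lnpP; lra.
have logM : logn p N = logn p M.
  by rewrite def_N lognM ?(prime_gt0 pr_P) // logn_prime // (negbTE pP_neq).
have pM5040 : 5040 < INR (p * M) by rewrite INR_muln; nra.
have [m p'm def_M] := split_prime_factor M_gt0 pr_p.
have [m' P'm' def_M'] := split_prime_factor M_gt0 pr_P.
have rho_N' : rho (p * M) = rho M * (1 + pgain p (logn p N)).
  by rewrite logM {1}def_M mulnA -expnS rho_pfactorS // -def_M.
have rho_N : rho N = rho M * (1 + pgain P (logn P M)).
  by rewrite def_N {1}def_M' mulnA -expnS rho_pfactorS // -def_M'.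
have L_def : L = ln (INR P) + ln (INR M).
  by rewrite /L def_N INR_muln ln_mult; lra.
have := LG_cross LGN pM5040.
rewrite rho_N rho_N' INR_muln ln_mult -/L; try lra.
move: (pgain_le (logn P M) pr_P).
set x := pgain p _ in gain *; set y := pgain P _ => y_le cross.
have rM := rho_gt0 M_gt0.
set d := ln (INR P) - ln (INR p).
have L'_def : ln (INR p) + ln (INR M) = L + - d by rewrite L_def /d; ring.
have M1 := ln_gt1 M5040.
have lnL' : ln (L + - d) <= ln L + - d / L by apply: ln_add_le; lra.
have y0 : 0 < y.
  have Pb := prime_le_pow (logn P M) pr_P.
  by apply: Rdiv_lt_0_compat; [|apply: Rmult_lt_0_compat]; lra.
have xy : (1 + x) * ln L <= (1 + y) * (ln L + - d / L).
  apply: (Rmult_le_reg_l (rho M)) => //.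
  rewrite L'_def in cross.
  have := Rmult_le_compat_l (rho M * (1 + y)) _ _ _ lnL'.
  by have := Rmult_lt_0_compat (rho M) (1 + y) rM ltac:(lra); lra.
have lnL_P : ln L < ln (INR P) by apply: ln_increasing; lra.
(* Here [d >= ln P / 2] comes from [p ^ 2 <= P], and [L < P] is used twice. *)
have dL : ln L * / (2 * INR P) < d / L.
  have invL : / INR P < / L by apply: Rinv_lt_contravar; nra.
  have P0 : 0 < / INR P by apply: Rinv_0_lt_compat; lra.
  rewrite /Rdiv Rinv_mult.
  have : ln L / 2 < d by rewrite /d; lra.
  by nra.
have yx : y - x < / (2 * INR P).
  have : (INR p - 1) / (INR p * INR P) = / INR P - / INR p * / INR P.
    by field; lra.
  have P0 : 0 < / INR P by apply: Rinv_0_lt_compat; lra.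
  have : / INR p <= / 2 by apply: Rinv_le_contravar; lra.
  by rewrite Rinv_mult; nra.
have dL0 : 0 < d / L by apply: Rdiv_lt_0_compat; rewrite ?/d; lra.
have lnL0 : 0 < ln L by lra.
have := Rmult_lt_compat_l _ _ _ lnL0 yx.
rewrite (_ : - d / L = - (d / L)) in xy; last by rewrite /Rdiv; ring.
by have := Rmult_lt_0_compat _ _ y0 dL0; lra.
Qed.

(** * Back to the factorization *)

Lemma Int_part_ln_ratio_le p P a : prime p -> prime P -> (P < p ^ a.+1)%N ->
  (Int_part (ln (INR P) / ln (INR p)) <= Z.of_nat a)%Z.
Proof.
move=> pr_p pr_P /INR_ltn; rewrite INR_expn => lt_P.
have p2 := prime_ge2 pr_p; have P2 := prime_ge2 pr_P.
have lnp0 : 0 < ln (INR p) by rewrite -ln_1; apply: ln_increasing; lra.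
have : ln (INR P) < INR a.+1 * ln (INR p).
  by rewrite -ln_pow; [apply: ln_increasing; lra | lra].
move=> lt_ln.
have lt_ratio : ln (INR P) / ln (INR p) < INR a.+1.
  apply: (Rmult_lt_reg_r (ln (INR p))) => //.
  by rewrite /Rdiv Rmult_assoc Rinv_l; lra.
have [le_ratio _] := base_Int_part (ln (INR P) / ln (INR p)).
have : IZR (Int_part (ln (INR P) / ln (INR p))) < IZR (Z.of_nat a.+1).
  by rewrite -INR_IZR_INZ; lra.
by move=> /lt_IZR; lia.
Qed.

Lemma logn_prod_primes r (p a : nat -> nat) i :
  (forall j, (1 <= j <= r)%N -> prime (p j)) ->
  (forall j k, (1 <= j)%N -> (j < k)%N -> (k <= r)%N -> (p j < p k)%N) ->
  (1 <= i <= r)%N ->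
  logn (p i) (\prod_(1 <= j < r.+1) p j ^ a j) = a i.
Proof.
move=> pr_p lt_p i_r; have pr_pi := pr_p i i_r.
have i_in : i \in index_iota 1 r.+1 by rewrite mem_index_iota ltnS.
rewrite (bigD1_seq i) ?iota_uniq //=.
rewrite mulnC logn_Gauss ?pfactorK // big_seq_cond.
apply: (big_ind (fun m => coprime (p i) m)); first exact: coprimen1.
  by move=> m n co_m co_n; rewrite coprimeMr co_m.
move=> j /andP []; rewrite mem_index_iota ltnS => j_r neq_ji.
apply: coprimeXr; rewrite prime_coprime // dvdn_prime2 ?pr_p //.
have /andP [i1 ir] := i_r; have /andP [j1 jr] := j_r.
have [lt_ij | lt_ji | eq_ij] := ltngtP i j.
- by rewrite neq_ltn lt_p.
- by rewrite neq_ltn (lt_p j i) ?orbT.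
- by rewrite eq_ij eqxx in neq_ji.
Qed.

Theorem theorem5 (N r : nat) (p a : nat -> nat)
  (hLG : LG N)
  (hN : Rpower 10 (10 ^ 13) < INR N)
  (hp : forall i : nat, (1 <= i <= r)%N -> prime (p i))
  (hlt : forall i j : nat, (1 <= i)%N -> (i < j)%N -> (j <= r)%N -> (p i < p j)%N)
  (ha : forall i : nat, (1 <= i <= r)%N -> (1 <= a i)%N)
  (hfact : N = (\prod_(1 <= i < r.+1) p i ^ a i)%N) :
  forall i : nat, (1 <= i <= r)%N ->
    (Int_part (ln (INR (p r)) / ln (INR (p i))) <= Z.of_nat (a i))%Z.
Proof.
move=> i i_r.
have r_r : (1 <= r <= r)%N.
  by case/andP: i_r => i1 ir; rewrite leqnn (leq_trans i1 ir).
have lognN j : (1 <= j <= r)%N -> logn (p j) N = a j.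
  by move=> j_r; rewrite hfact logn_prod_primes.
have p_N j : (1 <= j <= r)%N -> (p j %| N)%N.
  move=> j_r; have : (0 < logn (p j) N)%N by rewrite lognN ?ha.
  by rewrite logn_gt0 mem_primes => /and3P [].
apply: Int_part_ln_ratio_le; rewrite ?hp // -lognN //.
by apply: LG_prime_lt_pfactorS; rewrite ?hp ?p_N.
Qed.
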